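(* Let $S=[Y;B_\alpha;\phi_{\alpha,\beta}]$ be a dual weak brace. (a) If $S$ is left annihilator nilpotent of index $n$, then for every $\alpha\in Y$ the skew brace $B_\alpha$ is left annihilator nilpotent of index less than or equal to $n$. (b) Vice versa, if each skew brace $B_\alpha$ ($\alpha\in Y$) is left annihilator nilpotent of index $k_\alpha$, then $S$ is left annihilator nilpotent of index equal to the maximum of the $k_\alpha$, $\alpha\in Y$.
   Context: A dual weak brace is a triple $(S,+,\circ)$ such that $(S,+)$ is an inverse semigroup, $(S,\circ)$ is a Clifford semigroup (inverse semigroup with central idempotents), and $a\circ(b+c)=a\circ b-a+a\circ c$, $a\circ a^-=-a+a$ for all $a,b,c$, where $-a$, $a^-$ are the inverses of $a$ in $(S,+)$, $(S,\circ)$; then $(S,+)$ is also Clifford and the idempotents of both operations coincide, their set being $\mathrm{E}(S)$. A skew brace is a dual weak brace with exactly one idempotent (both structures are groups). Put $a^0=a-a=a\circ a^-$ and $\lambda_a(b)=-a+a\circ b$. Notation $S=[Y;B_\alpha;\phi_{\alpha,\beta}]$: $Y$ is a (lower) semilattice, the $B_\alpha$ ($\alpha\in Y$) are pairwise disjoint skew braces, $\phi_{\alpha,\beta}:B_\alpha\to B_\beta$ ($\alpha\ge\beta$) are skew brace homomorphisms with $\phi_{\alpha,\alpha}=\mathrm{id}$ and $\phi_{\beta,\gamma}\phi_{\alpha,\beta}=\phi_{\alpha,\gamma}$ for $\alpha\ge\beta\ge\gamma$, and $S=\bigcup_\alpha B_\alpha$ with $a+b=\phi_{\alpha,\alpha\beta}(a)+\phi_{\beta,\alpha\beta}(b)$,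 $a\circ b=\phi_{\alpha,\alpha\beta}(a)\circ\phi_{\beta,\alpha\beta}(b)$ for $a\in B_\alpha,b\in B_\beta$; every dual weak brace is of this form. A normal subsemigroup of a Clifford semigroup $T$ is a subset $I$ containing all idempotents of $T$, closed under products and inverses, with $a^{-1}Ia\subseteq I$ for all $a\in T$. An ideal of $S$ is a subset $I$ that is a normal subsemigroup of both $(S,+)$ and $(S,\circ)$ with $\lambda_a(I)\subseteq I$ for all $a\in S$. For an ideal $I$, the relation $a\sim_I b\iff a^0=b^0$ and $-a+b\in I$ is a congruence of $(S,+,\circ)$, and $S/I:=S/{\sim_I}$ is a dual weak brace; if $I\subseteq J$ are ideals, $J/I$ is the image of $J$ in $S/I$. The socle is $\mathrm{Soc}(S)=\{a\in S\mid \forall b\in S:\ a+b=a\circ b,\ a+b=b+a\}$, an ideal of $S$. Set $\mathrm{Soc}_0(S)=\mathrm{E}(S)$ and, for $n\ge1$, let $\mathrm{Soc}_n(S)$ be the ideal of $S$ containing $\mathrm{Soc}_{n-1}(S)$ with $\mathrm{Soc}_n(S)/\mathrm{Soc}_{n-1}(S)=\mathrm{Soc}(S/\mathrm{Soc}_{n-1}(S))$. An $s$-series of $S$ is a chain of ideals $\mathrm{E}(S)=I_0\subseteq I_1\subseteq\dots\subseteq I_m=S$ with $I_j/I_{j-1}\subseteq\mathrm{Soc}(S/I_{j-1})$ for $1\le j\le m$. $S$ is left annihilator nilpotent if it admits an $s$-series, equivalently $S=\mathrm{Soc}_n(S)$ for some $n$; the smallest non-negative integer $n$ with $S=\mathrm{Soc}_n(S)$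 is its left annihilator nilpotency index. All these notions apply in particular to skew braces.
   Formalization: In (b) it is assumed that the maximum of the k_α exists; if Y is infinite and the k_α are unbounded, S is not left annihilator nilpotent and the claim as worded fails. *)

(* Defs.v *)
(* Subsets are [set S] (Prop-valued) and carriers are [choiceType]s, which
   classically is no restriction. *)
From HB Require Import structures.
From mathcomp Require Import all_boot all_order.
From mathcomp Require Import boolp classical_sets.

Set Implicit Arguments.
Unset Strict Implicit.
Unset Printing Implicit Defensive.

Import Order.TTheory.

Declare Scope brace_scope.
Delimit Scope brace_scope with B.
Local Open Scope classical_set_scope.
Local Open Scope quotient_scope.

Section Semigroups.
Variables (T : Type) (op : T -> T -> T) (inv : T -> T).

Definition inverse_semigroup : Prop :=
  [/\ associative op,
      forall a, op (op a (inv a)) a = a,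
      forall a, op (op (inv a) a) (inv a) = inv a
    & forall a x, op (op a x) a = a -> op (op x a) x = x -> x = inv a].

Definition clifford_semigroup : Prop :=
  inverse_semigroup /\ forall e a, op e e = e -> op e a = op a e.

Definition normal_subsemigroup (I : set T) : Prop :=
  [/\ forall e, op e e = e -> I e,
      forall a b, I a -> I b -> I (op a b),
      forall a, I a -> I (inv a)
    & forall a i, I i -> I (op (op (inv a) i) a)].

End Semigroups.

HB.mixin Record isDualWeakBrace S of Choice S := {
  badd : S -> S -> S;
  bopp : S -> S;
  bcirc : S -> S -> S;
  binv : S -> S;
  badd_inverse_semigroup : inverse_semigroup badd bopp;
  bcirc_clifford : clifford_semigroup bcirc binv;
  bcircD : forall a b c,
    bcirc a (badd b c) = badd (badd (bcirc a b) (bopp a)) (bcirc a c);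
  bcircV : forall a, bcirc a (binv a) = badd (bopp a) a
}.

#[short(type="dualWeakBraceType")]
HB.structure Definition DualWeakBrace := { S of Choice S & isDualWeakBrace S }.

Notation "x + y" := (badd x y) : brace_scope.
Notation "- x" := (bopp x) : brace_scope.
Notation "x - y" := (badd x (bopp y)) : brace_scope.
Notation "x ** y" := (bcirc x y)
  (at level 40, left associativity) : brace_scope.
Notation "x ^-1" := (binv x) : brace_scope.

HB.mixin Record isSkewBrace S of DualWeakBrace S := {
  unique_idempotent : exists! e : S, badd e e = e
}.

#[short(type="skewBraceType")]
HB.structure Definition SkewBrace :=
  { S of DualWeakBrace S & isSkewBrace S }.

Definition brace_hom (A B : dualWeakBraceType) (f : A -> B) : Prop :=
  {morph f : x y / badd x y} /\ {morph f : x y / bcirc x y}.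

(* The idempotents of both operations coincide: see [add_circ_idem]. *)
Definition idempotents (S : dualWeakBraceType) : set S :=
  [set e | badd e e = e].
Arguments idempotents : clear implicits.

(* a^0; see [bcirc_zero] for a^0 = a ** a^-1. *)
Definition bzero (S : dualWeakBraceType) (a : S) : S := (a - a)%B.

Definition lambda (S : dualWeakBraceType) (a b : S) : S := (- a + a ** b)%B.

Definition is_ideal (S : dualWeakBraceType) (I : set S) : Prop :=
  [/\ normal_subsemigroup (@badd S) (@bopp S) I,
      normal_subsemigroup (@bcirc S) (@binv S) I
    & forall a i, I i -> I (lambda a i)].

Record ideal (S : dualWeakBraceType) :=
  Ideal { ideal_set :> set S; idealP : is_ideal ideal_set }.

Section CliffordTheory.
Variables (T : Type) (op : T -> T -> T) (inv : T -> T).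
Hypothesis cl : clifford_semigroup op inv.
Local Notation "x * y" := (op x y).
Local Notation "x ^-1" := (inv x).
Local Notation z a := (a * a^-1).

Lemma cA : associative op. Proof. by case: cl => -[]. Qed.
Lemma cK a : a * a^-1 * a = a. Proof. by case: cl => -[_ ->]. Qed.
Lemma cVK a : a^-1 * a * a^-1 = a^-1. Proof. by case: cl => -[_ _ ->]. Qed.
Lemma cU a x : a * x * a = a -> x * a * x = x -> x = a^-1.
Proof. by case: cl => -[_ _ _ h] _; apply: h. Qed.
Lemma cC e a : e * e = e -> e * a = a * e.
Proof. by case: cl => _; apply. Qed.

Lemma cinvK a : a^-1^-1 = a.
Proof. by symmetry; apply: cU; [apply: cVK | apply: cK]. Qed.

Lemma cz_idem a : z a * z a = z a. Proof. by rewrite cA cK. Qed.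
Lemma cVz_idem a : (a^-1 * a) * (a^-1 * a) = a^-1 * a.
Proof. by rewrite cA cVK. Qed.

Lemma czC a : a^-1 * a = z a.
Proof.
have e1 : z a * (a^-1 * a) = a^-1 * a.
  by rewrite cA [z a * _](cC _ (cz_idem a)) -cA cK.
have e2 : (a^-1 * a) * z a = z a.
  by rewrite cA (cC a (cVz_idem a)) cA cK.
by rewrite -e1 (cC _ (cz_idem a)) e2.
Qed.

Lemma czV a : z a^-1 = z a. Proof. by rewrite cinvK czC. Qed.
Lemma czl a : z a * a = a. Proof. exact: cK. Qed.
Lemma czr a : a * z a = a. Proof. by rewrite -(cC _ (cz_idem a)) cK. Qed.
Lemma czVl a : z a * a^-1 = a^-1. Proof. by rewrite -czC cVK. Qed.
Lemma czVr a : a^-1 * z a = a^-1.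
Proof. by rewrite -(cC _ (cz_idem a)) czVl. Qed.
Lemma czX a b : z a * b = b * z a. Proof. exact: cC (cz_idem a). Qed.

Lemma cidemV e : e * e = e -> e^-1 = e.
Proof. by move=> h; symmetry; apply: cU; rewrite !h. Qed.
Lemma czE e : e * e = e -> z e = e.
Proof. by move=> h; rewrite cidemV. Qed.
Lemma czz a : z (z a) = z a. Proof. exact: czE (cz_idem a). Qed.

Lemma cabsorb e f a b :
  f * f = f -> e * a = a -> f * b = b -> e * f * (a * b) = a * b.
Proof. by move=> hf ea fb; rewrite -cA (cA f) (cC a hf) -cA fb cA ea. Qed.

Lemma cinvM a b : (a * b)^-1 = b^-1 * a^-1.
Proof.
have e1 : a * b * (b^-1 * a^-1) = z a * z b.
  by rewrite -cA (cA b) czX cA.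
have e2 : b^-1 * a^-1 * (a * b) = z a * z b.
  by rewrite -cA (cA a^-1) czC czX cA czC -czX.
symmetry; apply: cU; first by rewrite e1 cabsorb ?czl // cz_idem.
by rewrite e2 (czX a) cabsorb ?czVl // cz_idem.
Qed.

Lemma czM a b : z (a * b) = z a * z b.
Proof. by rewrite cinvM -cA (cA b) czX cA. Qed.

Lemma cidemM e f : e * e = e -> f * f = f -> (e * f) * (e * f) = e * f.
Proof. by move=> /czE <- /czE <-; rewrite -czM cz_idem. Qed.

Lemma cJ_idem a e : e * e = e -> a^-1 * e * a = e * z a.
Proof. by move=> he; rewrite -cA (cC a he) cA czC -(cC _ he). Qed.

Variable I : set T.
Hypothesis nI : normal_subsemigroup op inv I.

Definition ccong a b : Prop := z a = z b /\ I (a^-1 * b).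

Lemma cI_idem e : e * e = e -> I e. Proof. by case: nI => + _ _ _; apply. Qed.
Lemma cI_z a : I (z a). Proof. exact/cI_idem/cz_idem. Qed.
Lemma cI_M a b : I a -> I b -> I (a * b).
Proof. by case: nI => _ + _ _; apply. Qed.
Lemma cI_V a : I a -> I a^-1. Proof. by case: nI => _ _ + _; apply. Qed.
Lemma cI_J a i : I i -> I (a^-1 * i * a).
Proof. by case: nI => _ _ _; apply. Qed.
Lemma cI_JV a i : I i -> I (a * i * a^-1).
Proof. by move=> /(cI_J a^-1); rewrite cinvK. Qed.

Lemma ccong_refl a : ccong a a.
Proof. by split=> //; rewrite czC; apply: cI_z. Qed.

Lemma ccong_sym a b : ccong a b -> ccong b a.
Proof.
by move=> [e /cI_V]; rewrite cinvM cinvK; split.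
Qed.

Lemma ccong_trans b a c : ccong a b -> ccong b c -> ccong a c.
Proof.
move=> [e1 i1] [e2 i2]; split; first by rewrite e1.
by have := cI_M i1 i2; rewrite -cA (cA b) -e1 cA czVr.
Qed.

Lemma ccong_swap a b : I (a^-1 * b) -> z a = z b -> I (a * b^-1).
Proof.
move=> /cI_V; rewrite cinvM cinvK => /(cI_JV a) h e.
by move: h; rewrite -!cA e czVr.
Qed.

Lemma ccongM a b c d : ccong a b -> ccong c d -> ccong (a * c) (b * d).
Proof.
move=> [e1 i1] [e2 i2]; split; first by rewrite !czM e1 e2.
have -> : (a * c)^-1 * (b * d) = (c^-1 * (a^-1 * b) * c) * (c^-1 * d).
  by rewrite cinvM -!cA (cA c c^-1 d) e2 czl.
by apply: cI_M => //; apply: cI_J.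
Qed.

Lemma ccongV a b : ccong a b -> ccong a^-1 b^-1.
Proof.
by move=> [e i]; split; rewrite ?czV // cinvK; apply: ccong_swap.
Qed.

Lemma ccongI a : I a -> ccong a (z a).
Proof.
by move=> i; split; rewrite ?czz // czVr; apply: cI_V.
Qed.

Lemma ccong_idem e : ccong (e * e) e -> ccong e (z e).
Proof.
move=> /ccong_sym[_]; rewrite cA czC czl => i; exact: ccongI.
Qed.

Lemma ccongU a x :
  ccong (a * x * a) a -> ccong (x * a * x) x -> ccong x a^-1.
Proof.
move=> /ccong_sym[e1 i1] [e2 _].
have ef e f : e * e = e -> e * f * e = e * f.
  by move=> he; rewrite -cA -(cC f he) cA he.
have e : z x = z a.
  rewrite !czM ef ?cz_idem // in e1; rewrite !czM ef ?cz_idem // in e2.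
  by rewrite [RHS]e1 czX e2.
split; first by rewrite czV.
rewrite -cinvM; apply: cI_V.
move: i1; rewrite !cA czC -(cA _ x) czX -cA czr => /(cI_JV a).
by rewrite -!cA -e czr.
Qed.

Lemma ccong_saturated a b : I a -> ccong a b -> I b.
Proof.
by move=> ia [e ib]; have := cI_M ia ib; rewrite cA e czl.
Qed.

End CliffordTheory.

Section BraceTheory.
Variable S : dualWeakBraceType.
Implicit Types a b c e f x y : S.
Local Open Scope brace_scope.

Local Notation circP := (@bcirc_clifford S).

Let addA : associative (@badd S).
Proof. by case: (@badd_inverse_semigroup S). Qed.
Let addK a : a - a + a = a.
Proof. by case: (@badd_inverse_semigroup S). Qed.
Let addVK a : - a + a - a = - a.
Proof. by case: (@badd_inverse_semigroup S). Qed.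
Let addU a x : a + x + a = a -> x + a + x = x -> x = - a.
Proof. by case: (@badd_inverse_semigroup S) => _ _ _; apply. Qed.
Let oppK a : - - a = a.
Proof. by symmetry; apply: addU. Qed.
Let add_idemN e : e + e = e -> - e = e.
Proof. by move=> h; symmetry; apply: addU; rewrite !h. Qed.

Let add_idemD e f : e + e = e -> f + f = f -> (e + f) + (e + f) = e + f.
Proof.
move=> he hf; set x := - (e + f).
have ex : f + x + e = x.
  apply: addU.
    by rewrite !addA -(addA e f f) hf -(addA _ e e) he -[RHS]addK !addA.
  rewrite !addA -(addA _ e e) he -(addA _ f f) hf.
  have /(congr1 (fun t => f + t + e)) := addVK (e + f).
  by rewrite -/x !addA.
have xx : x + x = x.
  rewrite -{1 2}ex; have /(congr1 (fun t => f + t + e)) := addVK (e + f).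
  by rewrite -/x !addA => ->; rewrite ex.
by rewrite -[e + f]oppK -/x add_idemN.
Qed.

Let add_idemC e f : e + e = e -> f + f = f -> e + f = f + e.
Proof.
move=> he hf.
have hef := add_idemD he hf; have hfe := add_idemD hf he.
rewrite -(add_idemN hfe); apply: addU.
  by rewrite !addA -(addA f e e) he -(addA _ f f) hf -[RHS]hfe !addA.
by rewrite !addA -(addA e f f) hf -(addA _ e e) he -[RHS]hef !addA.
Qed.

Let add_Videm a : (- a + a) + (- a + a) = - a + a.
Proof. by rewrite addA addVK. Qed.

Lemma add_circ_idem e : e + e = e <-> e ** e = e.
Proof.
split=> h.
  have -> : e = e ** e^-1 by rewrite bcircV add_idemN.
  exact: (cz_idem circP).
by rewrite -(czE circP h) bcircV add_Videm.
Qed.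

Let idem_circE e f : e + e = e -> f + f = f -> e + f = e ** f.
Proof.
move=> he hf.
have che := (add_circ_idem e).1 he; have chf := (add_circ_idem f).1 hf.
set g := e + f; set u := e ** f.
have hg : g + g = g by apply: add_idemD.
have hu : u + u = u by apply/add_circ_idem; apply: (cidemM circP).
have hle i : i + i = i -> u = u + i + u -> i + u = u.
  by move=> hi h; rewrite [RHS]h -addA (add_idemC hi hu) addA hu.
have eu : e + u = u.
  have : u = u - e + u by rewrite /u -{1}hf bcircD.
  by rewrite (add_idemN he); apply: hle.
have fu : f + u = u.
  have : u = u - f + u.
    by rewrite /u (cC circP f che) -bcircD he.
  by rewrite (add_idemN hf); apply: hle.
have ge : g ** e = u.
  rewrite -(cC circP g che) bcircD che (add_idemN he) he.
  exact: eu.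
have gf : g ** f = u.
  rewrite -(cC circP g chf) bcircD chf (add_idemN hf).
  rewrite -(cC circP f che) -/u.
  by rewrite -addA hf -(add_idemC hf hu).
have gu : g + u = u by rewrite /g -addA fu eu.
have gg : g ** g = g by apply/add_circ_idem.
rewrite -gg {2}/g bcircD ge gf (add_idemN hg).
by rewrite (add_idemC hu hg) gu hu.
Qed.

Let z_circ_idem e a : e + e = e -> - (e ** a) + e ** a = (- a + a) + e.
Proof.
move=> he; have che := (add_circ_idem e).1 he.
rewrite -bcircV (czM circP) (czE circP che) bcircV -idem_circE //.
exact: add_idemC.
Qed.

Let e_circ_addr e a : e + e = e -> e ** a + e = e ** a.
Proof.
move=> he.
have h : - (e ** a) + e ** a = (- a + a) + e by apply: z_circ_idem.
by rewrite -[e ** a]addK -(addA (e ** a)) h -!addA he.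
Qed.

Let circ_endo e a b : e + e = e -> e ** (a + b) = e ** a + e ** b.
Proof. by move=> he; rewrite bcircD add_idemN // e_circ_addr. Qed.

Let circ_endoN e a : e + e = e -> e ** (- a) = - (e ** a).
Proof.
by move=> he; apply: addU; rewrite -!circ_endo // ?addK ?addVK.
Qed.

Let oppD x y : - (x + y) = - y - x.
Proof.
have hx := add_Videm x; have hy : (y - y) + (y - y) = y - y.
  by rewrite addA addK.
symmetry; apply: addU.
  have -> : x + y + (- y - x) + (x + y) = x + ((y - y) + (- x + x)) + y.
    by rewrite !addA.
  rewrite (add_idemC hy hx).
  have -> : x + ((- x + x) + (y - y)) + y = (x - x + x) + (y - y + y).
    by rewrite !addA.
  by rewrite !addK.
have -> : - y - x + (x + y) + (- y - x) = - y + ((- x + x) + (y - y)) - x.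
  by rewrite !addA.
rewrite (add_idemC hx hy).
have -> : - y + ((y - y) + (- x + x)) - x = (- y + y - y) + (- x + x - x).
  by rewrite !addA.
by rewrite !addVK.
Qed.

Let e_circ_addl e a : e + e = e -> e + e ** a = e ** a.
Proof.
move=> he; have := e_circ_addr (- a) he.
by rewrite circ_endoN // => /(congr1 (@bopp S)); rewrite oppD oppK add_idemN.
Qed.

Lemma circ_add_lambda a x : a + lambda a x = a ** x.
Proof.
have hz : (a ** a^-1) + (a ** a^-1) = a ** a^-1.
  by apply/add_circ_idem; apply: (cz_idem circP).
have zx : a ** (a ** a^-1 ** x) = a ** x.
  by rewrite (cA circP) (czr circP).
rewrite -[in RHS]zx -(e_circ_addl _ hz) bcircD (czr circP) zx.
by rewrite /lambda addA.
Qed.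

Lemma lambdaD a x y : lambda a (x + y) = lambda a x + lambda a y.
Proof. by rewrite /lambda bcircD !addA. Qed.

Lemma lambdaN a x : lambda a (- x) = - lambda a x.
Proof. by apply: addU; rewrite -!lambdaD ?addK ?addVK. Qed.

Lemma lambda_circ a b c : lambda a (lambda b c) = lambda (a ** b) c.
Proof.
rewrite {2}/lambda lambdaD lambdaN {1 2}/lambda oppD oppK.
by rewrite -addA -/(lambda a (b ** c)) circ_add_lambda (cA circP).
Qed.

Let idem_circ_addr e a : e + e = e -> e ** a = a + e.
Proof.
move=> he; have che := (add_circ_idem e).1 he.
set h := lambda a e.
have hh : h + h = h by rewrite -lambdaD he.
have ea : e ** a = a + h by rewrite (cC circP a che) circ_add_lambda.
have zh : (- a + a) + h = (- a + a) + e.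
  rewrite -(z_circ_idem a he) ea oppD (add_idemN hh).
  have -> : h - a + (a + h) = h + ((- a + a) + h) by rewrite !addA.
  by rewrite [RHS]addA (add_idemC hh) // -[RHS]addA hh.
have H x : a + ((- a + a) + x) = a + x by rewrite !addA addK.
by rewrite ea -H zh H.
Qed.

Lemma idem_circ e a : e + e = e -> e ** a = e + a.
Proof.
move=> he; have := idem_circ_addr (- a) he.
by rewrite circ_endoN // => /(congr1 (@bopp S)); rewrite oppD !oppK add_idemN.
Qed.

Lemma badd_clifford : clifford_semigroup (@badd S) (@bopp S).
Proof.
split; first exact: badd_inverse_semigroup.
by move=> e a he; rewrite -idem_circ // idem_circ_addr.
Qed.

Local Notation addP := badd_clifford.

Lemma bcirc_zero a : a ** a^-1 = bzero a.
Proof. by rewrite bcircV (czC addP). Qed.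

Lemma lambda_idem e b : e + e = e -> lambda e b = e + b.
Proof. by move=> he; rewrite /lambda add_idemN // idem_circ // addA he. Qed.

Lemma bzero_idem a : bzero a + bzero a = bzero a.
Proof. exact: (cz_idem addP). Qed.

Lemma lambda_zero a b : bzero a + lambda a b = lambda a b.
Proof. by rewrite /lambda /bzero addA (czVl addP). Qed.

(* Both normal-subsemigroup structures of an ideal induce the same
   congruence. *)
Lemma ccong_add_circ (I : set S) a b : is_ideal I ->
  ccong (@badd S) (@bopp S) I a b <-> ccong (@bcirc S) (@binv S) I a b.
Proof.
move=> [nA nM lI]; rewrite /ccong !bcirc_zero /bzero.
split=> -[e i]; split=> //.
  have := lI a^-1 _ i.
  have -> : - a + b = lambda a (a^-1 ** b).
    rewrite /lambda (cA circP) bcirc_zero idem_circ ?bzero_idem // /bzero e.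
    by rewrite (czl addP).
  rewrite lambda_circ (czC circP) bcirc_zero lambda_idem ?bzero_idem //.
  rewrite -idem_circ ?bzero_idem // -bcirc_zero.
  by rewrite (cA circP) (czVl circP).
have := lI a _ i; rewrite /lambda (cA circP) bcirc_zero.
rewrite idem_circ ?bzero_idem //.
by rewrite /bzero e (czl addP).
Qed.

End BraceTheory.

Section Quotient.
Variables (S : dualWeakBraceType) (I : ideal S).
Implicit Types a b c : S.
Local Open Scope brace_scope.

Definition ideal_cong (a b : S) : Prop :=
  bzero a = bzero b /\ ideal_set I (- a + b).

Let nA : normal_subsemigroup (@badd S) (@bopp S) I.
Proof. by case: (idealP I). Qed.
Let nM : normal_subsemigroup (@bcirc S) (@binv S) I.
Proof. by case: (idealP I). Qed.
Let congA a b : ideal_cong a b = ccong (@badd S) (@bopp S) I a b.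
Proof. by []. Qed.
Let congM a b : ideal_cong a b <-> ccong (@bcirc S) (@binv S) I a b.
Proof. exact/ccong_add_circ/idealP. Qed.

Definition ideal_equiv : rel S := fun a b => `[< ideal_cong a b >].

Lemma ideal_equiv_refl : reflexive ideal_equiv.
Proof. by move=> a; apply/asboolP/(ccong_refl (badd_clifford S)). Qed.

Lemma ideal_equiv_sym : symmetric ideal_equiv.
Proof.
by move=> a b; apply/asboolP/asboolP; apply: (ccong_sym (badd_clifford S) nA).
Qed.

Lemma ideal_equiv_trans : transitive ideal_equiv.
Proof.
move=> b a c /asboolP h1 /asboolP h2; apply/asboolP.
exact: (ccong_trans (badd_clifford S) nA h1 h2).
Qed.

Canonical ideal_equiv_rel :=
  EquivRel ideal_equiv ideal_equiv_refl ideal_equiv_sym ideal_equiv_trans.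

Definition quot := {eq_quot ideal_equiv}.
HB.instance Definition _ := Choice.on quot.

Definition qproj (a : S) : quot := \pi_{eq_quot ideal_equiv} a.

Lemma qprojE a b : qproj a = qproj b <-> ideal_cong a b.
Proof.
split; first by move=> /eqmodP/asboolP.
by move=> h; apply/eqmodP/asboolP.
Qed.

Definition qrepr (x : quot) : S := repr (x : {eq_quot ideal_equiv}).

Lemma qreprK x : qproj (qrepr x) = x.
Proof. exact: reprK. Qed.

Lemma qproj_surj (x : quot) : exists a, qproj a = x.
Proof. by exists (qrepr x); rewrite qreprK. Qed.

Let reprE a : ideal_cong (qrepr (qproj a)) a.
Proof. by apply/qprojE; rewrite qreprK. Qed.

Definition qadd (x y : quot) : quot := qproj (qrepr x + qrepr y).
Definition qopp (x : quot) : quot := qproj (- qrepr x).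
Definition qcirc (x y : quot) : quot := qproj (qrepr x ** qrepr y).
Definition qinv (x : quot) : quot := qproj (qrepr x)^-1.

Lemma qaddE a b : qadd (qproj a) (qproj b) = qproj (a + b).
Proof. by apply/qprojE/(ccongM (badd_clifford S) nA); apply: reprE. Qed.
Lemma qoppE a : qopp (qproj a) = qproj (- a).
Proof. by apply/qprojE/(ccongV (badd_clifford S) nA)/reprE. Qed.
Lemma qcircE a b : qcirc (qproj a) (qproj b) = qproj (a ** b).
Proof.
by apply/qprojE/congM/(ccongM bcirc_clifford nM); apply/congM/reprE.
Qed.
Lemma qinvE a : qinv (qproj a) = qproj a^-1.
Proof. by apply/qprojE/congM/(ccongV bcirc_clifford nM); apply/congM/reprE. Qed.

Let qE := (qaddE, qoppE, qcircE, qinvE).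

Lemma qadd_inverse_semigroup : inverse_semigroup qadd qopp.
Proof.
have clS := badd_clifford S.
split.
- move=> x y z; have [a <-] := qproj_surj x; have [b <-] := qproj_surj y.
  have [c <-] := qproj_surj z.
  by rewrite !qE (cA clS).
- by move=> x; have [a <-] := qproj_surj x; rewrite !qE (cK clS).
- by move=> x; have [a <-] := qproj_surj x; rewrite !qE (cVK clS).
- move=> x y; have [a <-] := qproj_surj x; have [b <-] := qproj_surj y.
  by rewrite !qE => /qprojE h1 /qprojE h2; apply/qprojE/(ccongU clS nA h1 h2).
Qed.

Lemma qcirc_clifford : clifford_semigroup qcirc qinv.
Proof.
have clS := @bcirc_clifford S.
split; first split.
- move=> x y z; have [a <-] := qproj_surj x; have [b <-] := qproj_surj y.
  have [c <-] := qproj_surj z.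
  by rewrite !qE (cA clS).
- by move=> x; have [a <-] := qproj_surj x; rewrite !qE (cK clS).
- by move=> x; have [a <-] := qproj_surj x; rewrite !qE (cVK clS).
- move=> x y; have [a <-] := qproj_surj x; have [b <-] := qproj_surj y.
  rewrite !qE => /qprojE/congM h1 /qprojE/congM h2.
  by apply/qprojE/congM/(ccongU clS nM h1 h2).
move=> x y; have [e <-] := qproj_surj x; have [a <-] := qproj_surj y.
rewrite qE => /qprojE/congM/(ccong_idem clS nM)/congM/qprojE ->.
by rewrite !qE (czX clS).
Qed.

Lemma qcircD x y z :
  qcirc x (qadd y z) = qadd (qadd (qcirc x y) (qopp x)) (qcirc x z).
Proof.
have [a <-] := qproj_surj x; have [b <-] := qproj_surj y.
  have [c <-] := qproj_surj z.
by rewrite !qE bcircD.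
Qed.

Lemma qcircV x : qcirc x (qinv x) = qadd (qopp x) x.
Proof. by have [a <-] := qproj_surj x; rewrite !qE bcircV. Qed.

HB.instance Definition _ := isDualWeakBrace.Build quot
  qadd_inverse_semigroup qcirc_clifford qcircD qcircV.

(* [quot_set J] is J/I when J is an ideal containing I. *)
Definition quot_set (J : set S) : set quot := qproj @` J.

Lemma qproj_idem a : ideal_set I a -> idempotents quot (qproj a).
Proof.
move=> /(ccongI (badd_clifford S) nA) h.
have -> : qproj a = qproj (bzero a) by apply/qprojE.
by rewrite /idempotents /= [LHS]qaddE bzero_idem.
Qed.

Lemma qproj_add a b : qproj a + qproj b = qproj (a + b).
Proof. exact: qaddE. Qed.
Lemma qproj_opp a : - qproj a = qproj (- a).
Proof. exact: qoppE. Qed.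
Lemma qproj_circ a b : qproj a ** qproj b = qproj (a ** b).
Proof. exact: qcircE. Qed.
Lemma qproj_inv a : (qproj a)^-1 = qproj a^-1.
Proof. exact: qinvE. Qed.

Lemma preimage_is_ideal (J : ideal quot) : is_ideal (qproj @^-1` J).
Proof.
have [[aE aM aV aJ] [mE mM mV mJ] lJ] := idealP J.
have pE := (qproj_add, qproj_opp, qproj_circ, qproj_inv).
split; [split | split |].
- by move=> e he; apply: aE; rewrite pE he.
- by move=> a b ha hb; rewrite /preimage /= -pE; apply: aM.
- by move=> a ha; rewrite /preimage /= -pE; apply: aV.
- by move=> a i hi; rewrite /preimage /= -!pE; apply: aJ.
- by move=> e he; apply: mE; rewrite pE he.
- by move=> a b ha hb; rewrite /preimage /= -pE; apply: mM.
- by move=> a ha; rewrite /preimage /= -pE; apply: mV.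
- by move=> a i hi; rewrite /preimage /= -!pE; apply: mJ.
- by move=> a i hi; rewrite /preimage /= /lambda -!pE; apply: lJ.
Qed.

Definition preimage_ideal (J : ideal quot) : ideal S :=
  Ideal (preimage_is_ideal J).

End Quotient.

Arguments quot_set {S} I J x.

Section Socle.
Variable S : dualWeakBraceType.
Implicit Types a b c e i : S.
Local Open Scope brace_scope.

Lemma idempotents_is_ideal : is_ideal (idempotents S).
Proof.
have clA := badd_clifford S; have clM := @bcirc_clifford S.
split; [split | split |] => /=; rewrite /idempotents /=.
- by [].
- exact: (cidemM clA).
- by move=> a ha; rewrite (cidemV clA ha).
- move=> a i hi; rewrite (cJ_idem clA a hi).
  by apply: (cidemM clA) => //; apply: (cz_idem clA).
- by move=> e /add_circ_idem.
- move=> a b /add_circ_idem ha /add_circ_idem hb; apply/add_circ_idem.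
  exact: (cidemM clM).
- by move=> a /add_circ_idem ha; apply/add_circ_idem; rewrite (cidemV clM ha).
- move=> a i /add_circ_idem hi; apply/add_circ_idem.
  rewrite (cJ_idem clM a hi).
  by apply: (cidemM clM) => //; apply: (cz_idem clM).
- by move=> a i hi; rewrite -lambdaD hi.
Qed.

Definition idempotents_ideal : ideal S := Ideal idempotents_is_ideal.

Definition socle : set S :=
  [set a | forall b, a + b = a ** b /\ a + b = b + a].

Let lambda_socleC c i b : socle i -> lambda c i + b = b + lambda c i.
Proof.
have clA := badd_clifford S; have clM := @bcirc_clifford S.
have hz := bzero_idem c.
have eb : lambda c (lambda c^-1 b) = bzero c + b.
  by rewrite lambda_circ bcirc_zero lambda_idem.
move=> hi; have := congr1 (lambda c) (hi (lambda c^-1 b)).2.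
rewrite (lambdaD c i) (lambdaD c _ i) eb (cA clA) -(cC clA _ hz).
rewrite lambda_zero => ->.
by rewrite (cC clA b hz) -(cA clA) lambda_zero.
Qed.

Lemma socle_circ_conj c i : socle i ->
  c ** i ** c^-1 = lambda c i /\ socle (lambda c i).
Proof.
have clA := badd_clifford S; have clM := @bcirc_clifford S.
move=> hi; set l := lambda c i; have hz := bzero_idem c.
have lz : l + bzero c = l by rewrite -(cC clA _ hz) lambda_zero.
have hl b : l + b = c ** i ** c^-1 ** b.
  rewrite -!(cA clM) -(hi (c^-1 ** b)).1 bcircD (cA clM c).
  rewrite bcirc_zero (idem_circ _ hz) -circ_add_lambda -/l.
  rewrite -(lambda_socleC c c hi) -/l -(cA clA l) -/(bzero c) lz.
  by rewrite (cA clA) lz.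
have el : c ** i ** c^-1 = l.
  by have := hl (bzero c); rewrite lz -bcirc_zero -(cA clM) (czVr clM).
split=> // b; split; first by rewrite hl el.
exact: lambda_socleC.
Qed.

Lemma socle_is_ideal : is_ideal socle.
Proof.
have clA := badd_clifford S; have clM := @bcirc_clifford S.
have sD a c : socle a -> socle c -> socle (a + c).
  move=> ha hc b; split.
    by rewrite -(cA clA) (hc b).1 (ha _).1 (cA clM) -(ha c).1.
  by rewrite -(cA clA) (hc b).2 (cA clA) (ha b).2 -(cA clA).
have sE e : e + e = e -> socle e.
  by move=> he b; rewrite idem_circ // (cC clA b he).
have sN a : socle a -> - a = a^-1.
  move=> ha; rewrite -(czVr clA a) -/(bzero a) -bcirc_zero -(ha a^-1).1.
  rewrite (cA clA) (czC clA) -/(bzero a) -idem_circ ?bzero_idem // -bcirc_zero.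
  by rewrite (czVl clM).
have sV a : socle a -> socle (- a).
  move=> ha b; split.
    have := (ha (a^-1 ** b)).1.
    rewrite (cA clM) bcirc_zero => /(congr1 (badd (- a))).
    rewrite (cA clA) (czC clA) -/(bzero a) -(idem_circ _ (bzero_idem a)).
    rewrite -bcirc_zero (cA clM) (czVl clM) sN // bcirc_zero => ->.
    by rewrite (idem_circ _ (bzero_idem a)) (cA clA) -sN // /bzero (czVr clA).
  have zN : bzero a = - a + a by rewrite (czC clA).
  transitivity (bzero a + b - a).
    rewrite zN -(cA clA _ a) (ha b).2 (cA clA) -(cA clA _ a) -/(bzero a).
    by rewrite -(cA clA) -(cC clA b (bzero_idem a)) (cA clA) (czVr clA).
  by rewrite (cC clA b (bzero_idem a)) -(cA clA) (czVl clA).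
have sJ a i : socle i -> socle (- a + i + a).
  move=> hi; rewrite -(cA clA) (hi a).2 (cA clA) (czC clA).
  by apply: sD => //; apply/sE/bzero_idem.
split; [split | split |] => //.
- by move=> e /add_circ_idem; apply: sE.
- by move=> a b ha hb; rewrite -(ha b).1; apply: sD.
- by move=> a ha; rewrite -sN //; apply: sV.
- move=> a i /(socle_circ_conj a^-1); rewrite (cinvK clM) => -[-> //].
- by move=> a i /(socle_circ_conj a)[].
Qed.

Definition socle_ideal : ideal S := Ideal socle_is_ideal.

End Socle.

Arguments socle : clear implicits.

Fixpoint Soc (S : dualWeakBraceType) (n : nat) : ideal S :=
  if n is m.+1 then preimage_ideal (socle_ideal (quot (Soc S m)))
  else idempotents_ideal S.

(* [Soc S n.+1] is the unique ideal J containing [Soc S n] such that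
   J / Soc S n is the socle of S / Soc S n. *)

Lemma Soc_sub (S : dualWeakBraceType) n :
  ideal_set (Soc S n) `<=` ideal_set (Soc S n.+1).
Proof.
move=> a /qproj_idem h /=; rewrite /preimage /=.
by case: (socle_is_ideal (quot (Soc S n))) => -[+ _ _ _] _ _; apply.
Qed.

Lemma Soc_quot (S : dualWeakBraceType) n :
  quot_set (Soc S n) (ideal_set (Soc S n.+1)) = socle (quot (Soc S n)).
Proof.
apply/seteqP; split=> [x [a ha <-] // | x hx].
by have [a e] := qproj_surj x; exists a; rewrite //= /preimage /= e.
Qed.

Lemma Soc_unique (S : dualWeakBraceType) n (J : ideal S) :
  ideal_set (Soc S n) `<=` ideal_set J ->
  quot_set (Soc S n) (ideal_set J) = socle (quot (Soc S n)) ->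
  ideal_set J = ideal_set (Soc S n.+1).
Proof.
move=> sub e; apply/seteqP; split=> a.
  by move=> ja; rewrite /= /preimage /= -e; exists a.
rewrite /= /preimage /= -e => -[b jb /qprojE[e0 /sub jab]].
case: (idealP J) => nJ _ _.
exact: (ccong_saturated (badd_clifford S) nJ jb (conj e0 jab)).
Qed.

Definition s_series (S : dualWeakBraceType) (m : nat) (I : nat -> ideal S) :
  Prop :=
  [/\ ideal_set (I 0) = idempotents S,
      forall j, j < m -> ideal_set (I j) `<=` ideal_set (I j.+1),
      ideal_set (I m) = [set: S]
    & forall j, j < m ->
        quot_set (I j) (ideal_set (I j.+1)) `<=` socle (quot (I j))].

Definition left_annihilator_nilpotent (S : dualWeakBraceType) : Prop :=
  exists m (I : nat -> ideal S), s_series m I.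

(* [is_max k m]: the family k has a maximum, and it is m. *)
Definition is_max (Y : Type) (k : Y -> nat) (m : nat) : Prop :=
  (exists alpha, k alpha = m) /\ forall alpha, k alpha <= m.

Definition left_annihilator_nilpotent_of_index (S : dualWeakBraceType)
    (n : nat) : Prop :=
  [/\ left_annihilator_nilpotent S,
      ideal_set (Soc S n) = [set: S]
    & forall m, ideal_set (Soc S m) = [set: S] -> n <= m].

Record skew_brace_system (d : Order.disp_t) (Y : meetSemilatticeType d) :=
  SkewBraceSystem {
    fiber :> Y -> skewBraceType;
    phi : forall alpha beta : Y,
      (beta <= alpha)%O -> fiber alpha -> fiber beta;
    phi_hom : forall (alpha beta : Y) (h : (beta <= alpha)%O),
      brace_hom (phi h);
    phi_id : forall (alpha : Y) (h : (alpha <= alpha)%O) x, phi h x = x;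
    phi_comp : forall (alpha beta gamma : Y) (h1 : (beta <= alpha)%O)
        (h2 : (gamma <= beta)%O) (h : (gamma <= alpha)%O) x,
      phi h2 (phi h1 x) = phi h x
  }.

Section StrongSemilattice.
Variables (d : Order.disp_t) (Y : meetSemilatticeType d).
Variable B : skew_brace_system Y.
Local Open Scope brace_scope.

(* The tagged union plays the role of the disjoint union of the fibers. *)
Definition strong_semilattice := {alpha : Y & B alpha}.
HB.instance Definition _ := Choice.on strong_semilattice.

Definition inj_fiber (alpha : Y) (a : B alpha) : strong_semilattice :=
  existT _ alpha a.

Definition ss_op2 (op : forall alpha, B alpha -> B alpha -> B alpha)
    (x y : strong_semilattice) : strong_semilattice :=
  let: existT alpha a := x in let: existT beta b := y in
  inj_fiber (op _ (phi (leIl alpha beta) a) (phi (leIr beta alpha) b)).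

Definition ss_op1 (op : forall alpha, B alpha -> B alpha)
    (x : strong_semilattice) : strong_semilattice :=
  let: existT alpha a := x in inj_fiber (op _ a).

Definition ss_add := ss_op2 (fun alpha => @badd (B alpha)).
Definition ss_opp := ss_op1 (fun alpha => @bopp (B alpha)).
Definition ss_circ := ss_op2 (fun alpha => @bcirc (B alpha)).
Definition ss_inv := ss_op1 (fun alpha => @binv (B alpha)).

Lemma inj_fiber_inj (alpha : Y) : injective (@inj_fiber alpha).
Proof. by move=> a b /eqP; rewrite eq_Tagged => /eqP. Qed.

Section Op2.
Variable op : forall alpha, B alpha -> B alpha -> B alpha.
Hypothesis op_hom : forall (alpha beta : Y) (h : (beta <= alpha)%O),
  {morph (phi h : B alpha -> B beta) : x y / op x y}.
Variable inv : forall alpha, B alpha -> B alpha.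
Hypothesis cl : forall alpha, clifford_semigroup (@op alpha) (@inv alpha).

Lemma ss_op2E (alpha beta delta : Y) (h1 : (delta <= alpha)%O)
    (h2 : (delta <= beta)%O) a b : (alpha `&` beta)%O = delta ->
  ss_op2 op (inj_fiber a) (inj_fiber b) =
  inj_fiber (op (phi h1 a : B delta) (phi h2 b)).
Proof.
move=> e; case: delta / e h1 h2 => h1 h2 /=.
by rewrite (bool_irrelevance (leIl _ _) h1) (bool_irrelevance (leIr _ _) h2).
Qed.

Lemma ss_op2_same (alpha : Y) (a b : B alpha) :
  ss_op2 op (inj_fiber a) (inj_fiber b) = inj_fiber (op a b).
Proof. by rewrite (ss_op2E (lexx alpha) (lexx alpha)) ?meetxx // !phi_id. Qed.

Let op2A : associative (ss_op2 op).
Proof.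
move=> [alpha a] [beta b] [gamma c].
set delta := ((alpha `&` beta) `&` gamma)%O.
have ha : (delta <= alpha)%O by rewrite /delta -meetA leIl.
have hb : (delta <= beta)%O by rewrite /delta (meetC alpha) -meetA leIl.
have hc : (delta <= gamma)%O by rewrite leIr.
have hab : (delta <= alpha `&` beta)%O by rewrite leIl.
have hbc : (delta <= beta `&` gamma)%O by rewrite lexI hb.
rewrite -!/(inj_fiber _).
rewrite [in LHS](ss_op2E (leIl beta gamma) (leIr gamma beta)) //.
rewrite [in RHS](ss_op2E (leIl alpha beta) (leIr beta alpha)) //.
rewrite (ss_op2E ha hbc) ?meetA // (ss_op2E hab hc) // !op_hom.
by rewrite !(phi_comp _ _ hb) (phi_comp _ _ ha) (phi_comp _ _ hc) (cA (cl _)).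
Qed.
Let op1E (alpha : Y) (a : B alpha) :
  ss_op1 inv (inj_fiber a) = inj_fiber (inv a).
Proof. by []. Qed.

Let op2I : inverse_semigroup (ss_op2 op) (ss_op1 inv).
Proof.
split; first exact: op2A.
- move=> [alpha a]; have [[_ h _ _] _] := cl alpha.
  by rewrite -!/(inj_fiber _) op1E !ss_op2_same h.
- move=> [alpha a]; have [[_ _ h _] _] := cl alpha.
  by rewrite -!/(inj_fiber _) op1E !ss_op2_same h.
move=> [alpha a] [beta b] e1 e2.
have le1 := congr1 tag e1; have le2 := congr1 tag e2; rewrite /= in le1 le2.
have ab : alpha = beta.
  have h (x y : Y) : (x `&` y `&` x = x -> x <= y)%O.
    by move=> <-; apply: le_trans (leIl _ _) (leIr _ _).
  by apply: le_anti; rewrite (h _ _ le1) (h _ _ le2).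
case: beta / ab b e1 e2 {le1 le2} => b.
rewrite -!/(inj_fiber _) !ss_op2_same => /inj_fiber_inj e1 /inj_fiber_inj e2.
by have [[_ _ _ h] _] := cl alpha; congr inj_fiber; apply: h.
Qed.

Lemma ss_clifford : clifford_semigroup (ss_op2 op) (ss_op1 inv).
Proof.
split; first exact: op2I.
move=> [alpha e] [beta a]; rewrite -!/(inj_fiber _) ss_op2_same.
move=> /inj_fiber_inj he.
rewrite (ss_op2E (leIl alpha beta) (leIr beta alpha)) //.
rewrite (ss_op2E (leIr beta alpha) (leIl alpha beta)) 1?meetC //.
by rewrite (cC (cl _)) // -op_hom he.
Qed.

End Op2.

Let phiD (alpha beta : Y) (h : (beta <= alpha)%O) :
  {morph (phi h : B alpha -> B beta) : x y / badd x y}.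
Proof. by case: (phi_hom B h). Qed.

Let phiM (alpha beta : Y) (h : (beta <= alpha)%O) :
  {morph (phi h : B alpha -> B beta) : x y / bcirc x y}.
Proof. by case: (phi_hom B h). Qed.

Let phiN (alpha beta : Y) (h : (beta <= alpha)%O) (a : B alpha) :
  phi h (- a) = - (phi h a : B beta).
Proof.
apply: (cU (badd_clifford _)); rewrite -!phiD ?(cK (badd_clifford _)) //.
by rewrite (cVK (badd_clifford _)).
Qed.

Let clA alpha := badd_clifford (B alpha).
Let clM alpha := @bcirc_clifford (B alpha).

Lemma ss_add_clifford : clifford_semigroup ss_add ss_opp.
Proof. exact: (@ss_clifford (fun alpha => @badd (B alpha)) phiD
  (fun alpha => @bopp (B alpha)) clA). Qed.

Lemma ss_add_inverse_semigroup : inverse_semigroup ss_add ss_opp.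
Proof. by case: ss_add_clifford. Qed.

Lemma ss_circ_clifford : clifford_semigroup ss_circ ss_inv.
Proof. exact: (@ss_clifford (fun alpha => @bcirc (B alpha)) phiM
  (fun alpha => @binv (B alpha)) clM). Qed.

Lemma ss_circD x y z :
  ss_circ x (ss_add y z) =
  ss_add (ss_add (ss_circ x y) (ss_opp x)) (ss_circ x z).
Proof.
move: x y z => [alpha a] [beta b] [gamma c].
set delta := (alpha `&` (beta `&` gamma))%O.
have ha : (delta <= alpha)%O by rewrite leIl.
have hbc : (delta <= beta `&` gamma)%O by rewrite leIr.
have hb : (delta <= beta)%O by rewrite (le_trans hbc) ?leIl.
have hc : (delta <= gamma)%O by rewrite (le_trans hbc) ?leIr.
have hab : (delta <= alpha `&` beta)%O by rewrite lexI ha.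
have hac : (delta <= alpha `&` gamma)%O by rewrite lexI ha.
have e1 : (alpha `&` beta `&` alpha = alpha `&` beta)%O.
  by rewrite meetAC meetxx.
have e2 : (alpha `&` beta `&` (alpha `&` gamma) = delta)%O.
  by rewrite meetACA meetxx.
rewrite -!/(inj_fiber _) /ss_add /ss_circ.
have addE := @ss_op2E (fun alpha => @badd (B alpha)).
have circE := @ss_op2E (fun alpha => @bcirc (B alpha)).
have -> : ss_opp (inj_fiber a) = inj_fiber (- a) by [].
rewrite (addE _ _ _ (leIl beta gamma) (leIr gamma beta)) //.
rewrite (circE _ _ _ (leIl alpha beta) (leIr beta alpha)) //.
rewrite (circE _ _ _ (leIl alpha gamma) (leIr gamma alpha)) //.
rewrite (circE _ _ _ ha hbc) //.
rewrite (addE _ _ _ (lexx _) (leIl alpha beta)) //.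
rewrite (addE _ _ _ hab hac) //.
rewrite !(phiD, phiM, phiN) !phi_id.
rewrite !(phi_comp _ _ ha, phi_comp _ _ hb, phi_comp _ _ hc).
by rewrite bcircD.
Qed.

Lemma ss_circV x : ss_circ x (ss_inv x) = ss_add (ss_opp x) x.
Proof.
move: x => [alpha a]; rewrite -!/(inj_fiber _) /ss_add /ss_circ.
have -> : ss_opp (inj_fiber a) = inj_fiber (- a) by [].
have -> : ss_inv (inj_fiber a) = inj_fiber a^-1 by [].
by rewrite !ss_op2_same bcircV.
Qed.

HB.instance Definition _ := isDualWeakBrace.Build strong_semilattice
  ss_add_inverse_semigroup ss_circ_clifford ss_circD ss_circV.

End StrongSemilattice.

(* Main.v *)
(* Membership in Soc_{n+1} only refers to membership in Soc_n of the elements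
   -(a + b) + a ** b and -(a + b) + (b + a), because the condition on the zeros
   in the quotient congruence holds automatically.  The operations of a strong
   semilattice of skew braces are evaluated in the fibre over the meet, so by
   induction an element a of B_alpha lies in Soc_n(S) iff its image in B_beta
   lies in Soc_n(B_beta) for every beta <= alpha. *)
Require Import Defs.
From mathcomp Require Import all_boot all_order.
From mathcomp Require Import boolp classical_sets.

Import Order.TTheory.

Section SocleSeries.
Variable S : dualWeakBraceType.
Implicit Types a b : S.
Local Open Scope brace_scope.
Local Open Scope classical_set_scope.

Lemma bzeroD a b : bzero (a + b) = bzero a + bzero b.
Proof. exact: (czM (badd_clifford S)). Qed.

(** An idempotent acts by [**] as it does by [+], so the product of the two zeros for [**] is their
    sum. *)
Lemma bzeroM a b : bzero (a ** b) = bzero a + bzero b.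
Proof.
rewrite -bcirc_zero (czM (@bcirc_clifford S)) !bcirc_zero idem_circ //.
exact: bzero_idem.
Qed.

Lemma bzeroC a b : bzero a + bzero b = bzero b + bzero a.
Proof. exact: (cC (badd_clifford S) _ (bzero_idem a)). Qed.

Lemma SocSP n a :
  ideal_set (Soc S n.+1) a <->
  forall b, ideal_set (Soc S n) (- (a + b) + a ** b) /\
            ideal_set (Soc S n) (- (a + b) + (b + a)).
Proof.
have -> : ideal_set (Soc S n.+1) a =
    socle (quot (Soc S n)) (qproj (Soc S n) a).
  by [].
split=> h; [move=> b | move=> x].
  have [] := h (qproj (Soc S n) b); rewrite !(qproj_add, qproj_circ).
  by move=> /qprojE[_ h1] /qprojE[_ h2].
have [b <-] := qproj_surj x; have [h1 h2] := h b.
rewrite !(qproj_add, qproj_circ); split; apply/qprojE; split=> //.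
  by rewrite bzeroD bzeroM.
by rewrite !bzeroD bzeroC.
Qed.

(** Lets fibres of different indices be compared at one common index. *)
Lemma Soc_full_le m n : m <= n ->
  ideal_set (Soc S m) = [set: S] -> ideal_set (Soc S n) = [set: S].
Proof.
move=> /subnK <- e; elim: (n - m)%N => [|i IH]; first exact: e.
by rewrite addSn; apply/seteqP; split=> // x _; apply: Soc_sub; rewrite IH.
Qed.

Lemma Soc_full_nilpotent n :
  ideal_set (Soc S n) = [set: S] -> left_annihilator_nilpotent S.
Proof.
move=> e; exists n, (Soc S); split=> // j _; first exact: Soc_sub.
by rewrite Soc_quot.
Qed.

Lemma Soc_full_index n : ideal_set (Soc S n) = [set: S] ->
  exists k, left_annihilator_nilpotent_of_index S k /\ k <= n.
Proof.
move=> e.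
(* Reflecting the equality into a boolean allows taking the least such [k]. *)
have ex : exists k, `[< ideal_set (Soc S k) = [set: S] >].
  by exists n; apply/asboolP.
case: (ex_minnP ex) => k /asboolP ek kmin; exists k.
split; last exact/kmin/asboolP.
by split=> //; [exact: Soc_full_nilpotent ek | move=> m em; exact/kmin/asboolP].
Qed.

End SocleSeries.

Section StrongSemilatticeSocle.
Context {d : Order.disp_t} {Y : meetSemilatticeType d}.
Variable B : skew_brace_system Y.
Local Open Scope brace_scope.
Local Open Scope classical_set_scope.
Local Notation S := (strong_semilattice B).
Local Notation inj a := (inj_fiber a : S).

Lemma phiD {alpha beta : Y} (h : (beta <= alpha)%O) (a b : B alpha) :
  phi h (a + b) = phi h a + phi h b :> B beta.
Proof. by case: (phi_hom B h). Qed.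

Lemma phiM {alpha beta : Y} (h : (beta <= alpha)%O) (a b : B alpha) :
  phi h (a ** b) = phi h a ** phi h b :> B beta.
Proof. by case: (phi_hom B h). Qed.

Lemma phiN {alpha beta : Y} (h : (beta <= alpha)%O) (a : B alpha) :
  phi h (- a) = - phi h a :> B beta.
Proof.
have clA := badd_clifford.
by apply: (cU (clA _)); rewrite -!phiD ?(cK (clA _)) ?(cVK (clA _)).
Qed.

Lemma inj_addE {alpha beta gamma : Y} (h1 : (gamma <= alpha)%O)
    (h2 : (gamma <= beta)%O) (a : B alpha) (b : B beta) :
  (alpha `&` beta)%O = gamma ->
  inj a + inj b = inj (phi h1 a + phi h2 b : B gamma).
Proof. exact: (ss_op2E (fun alpha => @badd (B alpha))). Qed.

Lemma inj_circE {alpha beta gamma : Y} (h1 : (gamma <= alpha)%O)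
    (h2 : (gamma <= beta)%O) (a : B alpha) (b : B beta) :
  (alpha `&` beta)%O = gamma ->
  inj a ** inj b = inj (phi h1 a ** phi h2 b : B gamma).
Proof. exact: (ss_op2E (fun alpha => @bcirc (B alpha))). Qed.

Lemma inj_add {alpha : Y} (a b : B alpha) : inj a + inj b = inj (a + b).
Proof. exact: (ss_op2_same (fun alpha => @badd (B alpha))). Qed.

Lemma inj_opp {alpha : Y} (a : B alpha) : - inj a = inj (- a).
Proof. by []. Qed.

(** Keeping [gamma] a variable equal to the meet, rather than the meet itself, allows
    [gamma := beta] when [beta <= alpha] without any transport between fibres. *)
Lemma inj_commutators {alpha beta gamma : Y} (h1 : (gamma <= alpha)%O)
    (h2 : (gamma <= beta)%O) (a : B alpha) (b : B beta)
    (u := phi h1 a : B gamma) (v := phi h2 b : B gamma) :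
  (alpha `&` beta)%O = gamma ->
  - (inj a + inj b) + inj a ** inj b = inj (- (u + v) + u ** v) /\
  - (inj a + inj b) + (inj b + inj a) = inj (- (u + v) + (v + u)).
Proof.
move=> e; rewrite (inj_addE h1 h2) // (inj_circE h1 h2) //.
by rewrite (inj_addE h2 h1) 1?meetC // inj_opp !inj_add.
Qed.

Lemma Soc_injP n (alpha : Y) (a : B alpha) :
  ideal_set (Soc S n) (inj a) <->
  forall (beta : Y) (h : (beta <= alpha)%O),
    ideal_set (Soc (B beta) n) (phi h a).
Proof.
elim: n alpha a => [|n IH] alpha a.
  (* Homomorphisms preserve idempotents; conversely the fibre [alpha] itself suffices. *)
  rewrite /= /idempotents /= inj_add; split=> [/inj_fiber_inj e beta h|h].
    by rewrite -phiD e.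
  by congr inj_fiber; have := h alpha (lexx alpha); rewrite !phi_id.
split=> [/SocSP hs beta h|hs].
  (* For [b] in a fibre below [alpha] the meet is [beta], so both elements lie in [B beta], where
     the induction hypothesis is read through the identity map. *)
  apply/SocSP => b; have := hs (inj b).
  have [-> ->] := inj_commutators h (lexx beta) a b (meet_r h).
  rewrite !IH => -[/(_ _ (lexx beta)) + /(_ _ (lexx beta))].
  by rewrite !phi_id.
apply/SocSP => -[beta b]; rewrite -!/(inj_fiber _).
set gamma := (alpha `&` beta)%O.
have ha : (gamma <= alpha)%O := leIl _ _.
have hb : (gamma <= beta)%O := leIr _ _.
have [-> ->] := inj_commutators ha hb a b erefl.
(* Mapping further down to [delta] gives the same expressions in the images of [a] and [b] in
   [B delta], where the hypothesis on [a] applies. *)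
rewrite !IH; split=> delta h;
  have hda := le_trans h ha; have hdb := le_trans h hb;
  rewrite !(phiD, phiN, phiM) (phi_comp _ _ hda) (phi_comp _ _ hdb);
  by have /SocSP/(_ (phi hdb b))[] := hs delta hda.
Qed.

Lemma Soc_fullP n :
  ideal_set (Soc S n) = [set: S] <->
  forall alpha : Y, ideal_set (Soc (B alpha) n) = [set: B alpha].
Proof.
split=> [e alpha|e].
  apply/seteqP; split=> // a _.
  have : ideal_set (Soc S n) (inj a) by rewrite e.
  by move/Soc_injP/(_ _ (lexx alpha)); rewrite phi_id.
apply/seteqP; split=> // -[alpha a] _.
by apply/Soc_injP => beta h; rewrite e.
Qed.

End StrongSemilatticeSocle.

Theorem proposition5p10 (d : Order.disp_t) (Y : meetSemilatticeType d)
    (B : skew_brace_system Y) :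
  (forall n : nat,
     left_annihilator_nilpotent_of_index (strong_semilattice B) n ->
     forall alpha : Y, exists k : nat,
       left_annihilator_nilpotent_of_index (B alpha) k /\ k <= n)
  /\
  (forall k : Y -> nat,
     (forall alpha : Y, left_annihilator_nilpotent_of_index (B alpha) (k alpha)) ->
     forall m : nat, is_max k m ->
       left_annihilator_nilpotent_of_index (strong_semilattice B) m).
Proof.
split=> [n [_ e _] alpha | k hk m [[alpha <-] kmax]].
  exact/Soc_full_index/(Soc_fullP B n).1.
(* Here [alpha] attains the maximum, so every fibre is exhausted by step [k alpha]. *)
have e : ideal_set (Soc (strong_semilattice B) (k alpha)) = setT.
  by apply/Soc_fullP => beta; have [_ + _] := hk beta; apply: Soc_full_le.
(* Minimality is tested on this fibre alone: a step [j] exhausting the whole brace exhausts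
   [B alpha], whence [k alpha <= j]. *)
split=> [||j /Soc_fullP/(_ alpha)]; [exact: Soc_full_nilpotent e | exact: e |].
by have [_ _] := hk alpha; apply.
Qed.
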